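(* For every $n\ge1$, we have $\psi(K_n,+)=n$, where $(K_n,+)$ is the complete graph on $n$ vertices with all edges positive.
   Context: A signed graph $(G,\sigma)$ is a finite simple graph $G$ with a signature $\sigma:E(G)\to\{-,+\}$. Switching a set $S\subseteq V(G)$ changes the sign of every edge with exactly one end in $S$; two signed graphs on the same underlying graph are equivalent if one is obtained from the other by switching some set of vertices. For $k\ge1$ let $M_k=\{-n,\dots,-1,+1,\dots,+n\}$ if $k=2n$, and $M_k=\{-n,\dots,-1,\pm0,+1,\dots,+n\}$ if $k=2n+1$, where $\pm0$ is a single colour with $-(\pm0)=\pm0$. A $k$-colouring of $(G,\sigma)$ is a map $\phi:V(G)\to M_k$. Let $K_k^*$ be the signed multigraph with vertex set $\{i\ge 0: +i\in M_k\}$ (vertex $0$ standing for colour $\pm0$ when $k$ is odd), in which every two distinct vertices are joined by exactly one positive and one negative edge, and every vertex $i\neq0$ carries exactly one negative loop. Given a $k$-colouring $\phi$, the reduced signed graph $R(G,\sigma,\phi)$ is obtained by (1) switching every vertex with a negative colour $-i$ and recolouring it $+i$; (2) identifying, for each $i$, all vertices of colour $+i$ (resp. $\pm0$) into a single vertex $i$ (resp. $0$), edges inside a class becoming loops; (3) keeping at most one positive and at most one negative edge (or loop) between any two vertices (or at any vertex). The colouring $\phi$ is complete if $R(G,\sigma,\phi)$ is exactly $K_k^*$. The achromatic number $\psi(G,\sigma)$ is the largest $k\ge1$ such that some signed graph equivalent to $(G,\sigma)$ admits a complete $k$-colouring. *)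

(* Defs.v *)
From mathcomp Require Import all_boot all_order all_algebra.
Set Implicit Arguments.
Unset Strict Implicit.
Unset Printing Implicit Defensive.

Record graph (V : finType) := Graph {
  adj : rel V;
  adj_sym : symmetric adj;
  adj_irr : irreflexive adj
}.

Definition edges (V : finType) (G : graph V) : {set {set V}} :=
  [set e | [exists x, exists y, adj G x y && (e == [set x; y])]].

Notation sign := bool (only parsing).
Definition Pos : sign := true.
Definition Neg : sign := false.

(* A signature is total on sets of vertices, but every definition below only
   reads its values on the edges of the graph. *)
Definition signature (V : finType) := {set V} -> sign.

Definition switch (V : finType) (S : {set V}) (sigma : signature V) :
    signature V :=
  fun e => if #|e :&: S| == 1 then ~~ sigma e else sigma e.

Definition sg_equiv (V : finType) (G : graph V) (sigma tau : signature V) :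
    Prop :=
  exists S : {set V}, {in edges G, forall e, tau e = switch S sigma e}.

(* The colour +-0 is the integer 0; it belongs to M_k only for odd k. *)
Definition colours (k : nat) : pred int :=
  fun c => (`|c|%N <= k./2) && (odd k || (c != 0%R)).

Definition colouring (V : finType) (k : nat) (phi : V -> int) : Prop :=
  forall x, phi x \in colours k.

(* Signed multigraphs with vertices labelled by natural numbers:
   [mult H s i j] is the number of edges of sign s between the vertices i and j
   (of loops of sign s at i, when i = j). *)
Record smultigraph := SMultigraph {
  vertices : pred nat;
  mult : sign -> nat -> nat -> nat
}.

Definition smultigraph_eq (H K : smultigraph) : Prop :=
  vertices H =i vertices K /\
  {in vertices H &, forall i j, forall s, mult H s i j = mult K s i j}.

Definition Kstar (k : nat) : smultigraph :=
  SMultigraph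
    (fun i => Posz i \in colours k)
    (fun s i j => if i == j then ((s == Neg) && (i != 0) : nat) else 1).

Definition identify (V : finType) (G : graph V) (sigma : signature V)
    (f : V -> nat) : smultigraph :=
  SMultigraph
    (fun i => [exists x, f x == i])
    (fun s i j => #|[set e in edges G | (sigma e == s) &&
       [exists x, exists y, [&& e == [set x; y], f x == i & f y == j]]]|).

Definition simplify (H : smultigraph) : smultigraph :=
  SMultigraph (vertices H) (fun s i j => minn 1 (mult H s i j)).

Definition reduced (V : finType) (G : graph V) (sigma : signature V)
    (phi : V -> int) : smultigraph :=
  simplify (identify G (switch [set x | (phi x < 0)%R] sigma)
                     (fun x => `|phi x|%N)).

Definition complete_colouring (V : finType) (G : graph V)
    (sigma : signature V) (k : nat) (phi : V -> int) : Prop :=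
  colouring k phi /\ smultigraph_eq (reduced G sigma phi) (Kstar k).

Definition completely_colourable (V : finType) (G : graph V)
    (sigma : signature V) (k : nat) : Prop :=
  exists tau : signature V, sg_equiv G sigma tau /\
    exists phi : V -> int, complete_colouring G tau k phi.

Definition is_achromatic_number (V : finType) (G : graph V)
    (sigma : signature V) (k : nat) : Prop :=
  [/\ 1 <= k, completely_colourable G sigma k &
      forall l, 1 <= l -> completely_colourable G sigma l -> l <= k].

Lemma complete_adj_sym (n : nat) : symmetric (fun x y : 'I_n => x != y).
Proof. by move=> x y; rewrite eq_sym. Qed.

Lemma complete_adj_irr (n : nat) : irreflexive (fun x y : 'I_n => x != y).
Proof. by move=> x; rewrite eqxx. Qed.

Definition complete_graph (n : nat) : graph 'I_n :=
  Graph (@complete_adj_sym n) (@complete_adj_irr n).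

Definition all_positive (V : finType) : signature V := fun _ => Pos.
Arguments all_positive V : clear implicits.

(* Main.v *)
Require Import Defs.
From mathcomp Require Import all_boot all_order all_algebra.
From mathcomp Require Import zify.

(** Switching the all-positive complete graph gives each vertex [x] a bit [t x]
    such that the edge [xy] is positive iff [t x = t y]. In a complete
    [k]-colouring, the negative loop at each vertex [i <> 0] of [K_k^*] provides
    two vertices of [K_n] of colour [i] up to sign with distinct bits; together
    with a vertex of colour [0] when [k] is odd, this injects [M_k] into the
    vertices of [K_n], so [k <= n]. Conversely, any bijection from the vertices
    onto [M_n] is a complete [n]-colouring. *)

Lemma switch_pair (V : finType) (S : {set V}) (sigma : signature V) (x y : V) :
  x != y ->
  switch S sigma [set x; y] = sigma [set x; y] (+) (x \in S) (+) (y \in S).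
Proof.
move=> neq_xy; rewrite /switch setIUl cardsU.
have cap1 z : #|[set z] :&: S| = (z \in S).
  case: (boolP (z \in S)) => [zS | zNS].
    by rewrite (setIidPl _) ?cards1 ?sub1set.
  by apply/eqP; rewrite cards_eq0 setI_eq0 disjoints1.
have -> : [set x] :&: S :&: ([set y] :&: S) = set0.
  apply/setP=> z; rewrite !inE; case: eqP => [->|//] /=.
  by rewrite (negPf neq_xy) /= andbF.
rewrite cards0 subn0 !cap1.
by case: (x \in S); case: (y \in S); case: (sigma _).
Qed.

(** Simplification caps multiplicities at 1, so only the existence of an edge of each sign
    matters. *)
Lemma identify_mult_gt0 (n : nat) (sigma : signature 'I_n) (f : 'I_n -> nat)
    (s : bool) (i j : nat) :
  reflect
    (exists x y, [/\ x != y, f x = i, f y = j & sigma [set x; y] = s])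
    (0 < mult (identify (complete_graph n) sigma f) s i j).
Proof.
apply: (iffP card_gt0P) => [[e] | [x [y [neq_xy fx fy sxy]]]].
  rewrite !inE => /andP[/existsP[u /existsP[v /andP[/= neq_uv /eqP e_uv]]]].
  case/andP=> /eqP se /existsP[x /existsP[y /and3P[/eqP e_xy /eqP fx /eqP fy]]].
  exists x, y; split=> //; last by rewrite -e_xy.
  (* Edges are two-element sets, which rules out [x = y]. *)
  have : #|[set u; v]| = #|[set x; y]| by rewrite -e_uv e_xy.
  by rewrite !cards2 neq_uv; case: (x != y).
exists [set x; y]; rewrite !inE sxy eqxx /=; apply/andP; split.
  by apply/existsP; exists x; apply/existsP; exists y; rewrite /= neq_xy eqxx.
by apply/existsP; exists x; apply/existsP; exists y; rewrite fx fy !eqxx.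
Qed.

Lemma reduced_mult (V : finType) (G : graph V) (sigma : signature V)
    (phi : V -> int) (s : bool) (i j : nat) :
  mult (reduced G sigma phi) s i j =
  (0 < mult (identify G (switch [set x | (phi x < 0)%R] sigma)
                      (fun x => `|phi x|%N)) s i j).
Proof.
have minn1 m : minn 1 m = (0 < m) by lia.
exact: minn1.
Qed.

(* Enumerates [M_k] as [0, -1, 1, -2, 2, ...], skipping [0] when [k] is even. *)
Definition nth_colour (k i : nat) : int :=
  let m := i + ~~ odd k in
  if odd m then (- Posz (uphalf m))%R else Posz (uphalf m).

Lemma nth_colour_inj (k : nat) : injective (nth_colour k).
Proof. by move=> i j; rewrite /nth_colour; do !case: ifP; lia. Qed.

Lemma nth_colour_in (k i : nat) : i < k -> nth_colour k i \in colours k.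
Proof.
by move=> lt_ik; rewrite unfold_in /nth_colour; case: ifP; lia.
Qed.

Lemma nth_colour_onto (k : nat) (c : int) :
  c \in colours k -> exists i : 'I_k, nth_colour k i = c.
Proof.
rewrite unfold_in => c_col.
(* In the full list [c] has position [2|c|], less 1 if negative; even [k] shifts by 1, harmlessly
   since then [c] is nonzero. *)
pose i := (`|c|.*2 - (c < 0)%R - ~~ odd k)%N.
have lt_ik : i < k by rewrite /i; lia.
by exists (Ordinal lt_ik); rewrite /nth_colour /= /i; case: ifP; lia.
Qed.

Lemma bijective_colouring_complete (n : nat) (phi : 'I_n -> int) :
  injective phi -> colouring n phi ->
  (forall c, c \in colours n -> exists x, phi x = c) ->
  complete_colouring (complete_graph n) (all_positive 'I_n) n phi.
Proof.
move=> phi_inj phi_col phi_onto; split=> //.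
have ver : vertices (reduced (complete_graph n) (all_positive 'I_n) phi)
    =i vertices (Kstar n).
  move=> i; rewrite /= !unfold_in /=; apply/existsP/idP => [[x /eqP <-] | i_col].
    by have := phi_col x; rewrite !unfold_in; lia.
  by have [|x phix] := phi_onto (Posz i); [rewrite unfold_in | exists x; rewrite phix].
split=> // i j; rewrite !ver => i_col j_col s.
have onto (b : bool) h : h \in vertices (Kstar n) ->
    exists2 x, `|phi x|%N = h & (phi x < 0)%R = b && (h != 0).
  move=> h_col.
  have [|x phix] := phi_onto (if b then (- Posz h)%R else Posz h).
    by move: h_col; rewrite /= !unfold_in; case: b; lia.
  by exists x; rewrite phix; case: (b); lia.
have sgn x y : x != y ->
    switch [set x | (phi x < 0)%R] (all_positive 'I_n) [set x; y]
    = ((phi x < 0)%R == (phi y < 0)%R).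
  by move=> neq_xy; rewrite switch_pair // !inE; do 2!case: (_ < _)%R.
pose H := identify (complete_graph n)
  (switch [set x | (phi x < 0)%R] (all_positive 'I_n)) (fun x => `|phi x|%N).
suff pos_mult : (0 < mult H s i j) =
    (if i == j then (s == Neg) && (i != 0) else true).
  by rewrite reduced_mult pos_mult /=; case: eqP.
apply/identify_mult_gt0/idP => [[x [y [neq_xy fx fy]]] | Hij].
  (* Distinct vertices in one class have opposite nonzero colours, so a loop is negative and avoids
     0. *)
  rewrite sgn //; case: (i =P j) => // eq_ij sE.
  have : phi x <> phi y by move/phi_inj/eqP; rewrite (negPf neq_xy).
  by move: sE; rewrite /Neg; case: s; lia.
(* For a negative edge exactly one end must have a negative colour: [x], or [y] when [i = 0], as 0
   has no negative copy. *)
have [x fx sx] := onto (~~ s) i i_col.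
have [y fy sy] := onto (~~ s && (i == 0)) j j_col.
have neq_xy : x != y.
  apply/eqP=> eq_xy; have eq_ij : i = j by rewrite -fx -fy eq_xy.
  move: sx sy Hij; rewrite eq_xy => ->; rewrite -eq_ij eqxx /Neg.
  by case: (s); case: (i).
exists x, y; split=> //; rewrite sgn // sx sy.
by move: Hij; rewrite /Neg; case: (i =P j); case: (s); lia.
Qed.

Lemma complete_colouring_leq (n k : nat) (tau : signature 'I_n)
    (phi : 'I_n -> int) :
  sg_equiv (complete_graph n) (all_positive 'I_n) tau ->
  complete_colouring (complete_graph n) tau k phi -> k <= n.
Proof.
case=> S tauE [_ [ver mulE]].
(* The switching giving [tau] and the one made by the reduction compose to a single switching, with
   indicator [t]. *)
pose t x := (x \in S) (+) (phi x < 0)%R.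
have sgn x y : x != y ->
    switch [set x | (phi x < 0)%R] tau [set x; y] = (t x == t y).
  move=> neq_xy; rewrite switch_pair // tauE ?switch_pair // ?inE.
    by rewrite /t; do !case: (_ \in _); do !case: (_ < _)%R.
  by apply/existsP; exists x; apply/existsP; exists y; rewrite /= neq_xy eqxx.
(* The sign of the colour is matched with [t x], not with the sign of [phi x]: a class need not
   contain both signs of its colour. *)
have attained (i : 'I_k) : exists x, `|phi x|%N = `|nth_colour k i|%N /\
    (nth_colour k i != 0%R -> t x = (nth_colour k i < 0)%R).
  have := nth_colour_in _ _ (ltn_ord i); move: (nth_colour k i) => c c_col.
  have c_ver : `|c|%N \in vertices (reduced (complete_graph n) tau phi).
    by rewrite ver /= !unfold_in; move: c_col; rewrite unfold_in; lia.
  have [c_eq0 | c_neq0] := eqVneq c 0%R.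
    move: (c_ver); rewrite unfold_in => /existsP[x /eqP fx].
    by exists x; split=> //; rewrite c_eq0 eqxx.
  have /identify_mult_gt0[x [y [neq_xy fx fy]]] : 0 < mult (identify
      (complete_graph n) (switch [set x | (phi x < 0)%R] tau)
      (fun x => `|phi x|%N)) Neg `|c| `|c|.
    have := mulE _ _ c_ver c_ver Neg; rewrite reduced_mult.
    by case: (0 < _); rewrite //= eqxx absz_eq0 c_neq0.
  rewrite sgn // => t_xy.
  (* The ends of the negative loop have different bits, so one of them has the bit required. *)
  have [tx | tx] := eqVneq (t x) (c < 0)%R; first by exists x.
  by exists y; split=> // _; move: (t x) (t y) (c < 0)%R t_xy tx => [] [] [].
have [g gP] := fin_all_exists attained.
(* The vertex [g i] determines the absolute value of the colour and, if this is nonzero, its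
   sign. *)
have g_inj : injective g.
  move=> i j eq_g; apply/val_inj/(nth_colour_inj k).
  have [fi ti] := gP i; have [fj tj] := gP j.
  move: fi ti; rewrite eq_g; move: fj tj.
  by move: (nth_colour k i) (nth_colour k j) (t _) => c d b; lia.
by have := leq_card g g_inj; rewrite !card_ord.
Qed.

Theorem theorem2p10 (n : nat) (hn : 1 <= n) :
  is_achromatic_number (complete_graph n) (all_positive 'I_n) n.
Proof.
split=> // [|k _ [tau [tau_eq [phi phi_complete]]]]; last first.
  exact: complete_colouring_leq tau_eq phi_complete.
exists (all_positive 'I_n); split.
  by exists set0 => e _; rewrite /switch setI0 cards0.
exists (fun x : 'I_n => nth_colour n x); apply: bijective_colouring_complete.
- by move=> x y /nth_colour_inj/val_inj.
- by move=> x; apply: nth_colour_in.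
- exact: nth_colour_onto.
Qed.
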